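(* Let $p\ge17$ be prime, $A,B\in\mathbb{N}$, with $p\nmid\Delta=4A^3+27B^2$. Put $\bar A=A\bmod p$, $\bar B=B\bmod p$ and \[ r=\left(\left\lfloor\frac{\bigl(2^{3p^2}+\bar A\,2^{p^2}+\bar B\bigr)^{\lfloor p/2\rfloor}}{2^{p^2(p-1)}}\right\rfloor\bmod 2^{p^2}\right)\bmod p . \] For $k\ge1$ let $N_k=\#\{(x,y)\in(\mathbb{Z}/p^k\mathbb{Z})^2 : y^2=x^3+Ax+B\}$. Then for every $k\ge1$ \[ N_k=p^{\,k-1}\Bigl((p\mathbin{\dot{-}}r)+p\cdot\bigl(1\mathbin{\dot{-}}((4p+1)\mathbin{\dot{-}}r^2)\bigr)\Bigr), \] an arithmetic term in $A,B,p,k$.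
   Context: $\mathbb{N}$ includes $0$. Truncated subtraction is $x\mathbin{\dot{-}}y=\max(x-y,0)$; $a\bmod b$ is the least nonnegative residue. An arithmetic term is a fixed finite composition of addition, truncated subtraction, multiplication, integer division $\lfloor x/y\rfloor$ (with positive denominators) and exponentiation on natural numbers, with $0^0=1$. *)

(* Defs.v *)
From HB Require Import structures.
From mathcomp Require Import all_boot all_order all_algebra.

Set Implicit Arguments.
Unset Strict Implicit.
Unset Printing Implicit Defensive.

Import GRing.Theory.
Local Open Scope nat_scope.

(* Arithmetic terms in n variables.  Numerals are the nullary case of the
   compositions. *)
Inductive aterm (n : nat) : Type :=
  | TVar of 'I_n
  | TConst of nat
  | TAdd of aterm n & aterm n
  | TSub of aterm n & aterm n
  | TMul of aterm n & aterm n
  | TDiv of aterm n & aterm n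
  | TExp of aterm n & aterm n.

(* The value is undefined (None) as soon as some denominator vanishes, so that
   [aeval e t = Some v] includes the positivity of every denominator of t.
   Subtraction on nat is truncated and 0 ^ 0 = 1. *)
Fixpoint aeval (n : nat) (e : n.-tuple nat) (t : aterm n) : option nat :=
  let lift2 (op : nat -> nat -> option nat) (u v : aterm n) :=
    if aeval e u is Some a then
      if aeval e v is Some b then op a b else None
    else None in
  match t with
  | TVar i => Some (tnth e i)
  | TConst c => Some c
  | TAdd u v => lift2 (fun a b => Some (a + b)) u v
  | TSub u v => lift2 (fun a b => Some (a - b)) u v
  | TMul u v => lift2 (fun a b => Some (a * b)) u v
  | TDiv u v => lift2 (fun a b => if 0 < b then Some (a %/ b) else None) u v
  | TExp u v => lift2 (fun a b => Some (a ^ b)) u v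
  end.

(* 'Z_m is the ring of integers mod m only for 1 < m. *)
Definition affine_count (A B m : nat) : nat :=
  #|[set P : 'Z_m * 'Z_m |
      (P.2 ^+ 2 == P.1 ^+ 3 + A%:R * P.1 + B%:R)%R]|.

Definition trace_residue (A B p : nat) : nat :=
  ((2 ^ (3 * p ^ 2) + (A %% p) * 2 ^ (p ^ 2) + B %% p) ^ (p %/ 2)
     %/ 2 ^ (p ^ 2 * (p - 1))
     %% 2 ^ (p ^ 2)) %% p.

(* Main.v *)
Require Import Defs.
From mathcomp Require Import all_boot all_order all_algebra.
From mathcomp Require Import all_fingroup all_solvable all_field.
From mathcomp Require Import ring lra zify.

(* The number N of affine points over F_p satisfies N = p - c mod p, where c is
   the coefficient of x^(p-1) in (x^3 + A x + B)^((p-1)/2): evaluate the number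
   of square roots by Euler's criterion and use power sums.  The integer r is
   c mod p, since c is a digit of the power evaluated at 2^(p^2).  For p > 16
   Hasse's bound (N - p)^2 <= 4 p then decides between N = p - r and N = 2 p - r,
   and Hensel lifting at the nonsingular points gives the factor p^(k-1).

   Hasse's bound follows Manin: on the twisted curve over F_p(t), the degrees d_n
   of the numerators of x((t^p, f^((p-1)/2)) + n (t, 1)) satisfy
   d_(n-1) + d_(n+1) = 2 d_n + 2, so that the quadratic polynomial
   d_n = n^2 + n (p - N) + p is nonnegative at every integer n.  Only
   x-coordinates occur: neighbouring ones satisfy a symmetric biquadratic
   relation, and the sequence is produced by Vieta jumping on it instead of by
   the group law. *)

Set Implicit Arguments.
Unset Strict Implicit.
Unset Printing Implicit Defensive.

Import Order.TTheory GRing.Theory Num.Theory.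

Local Open Scope ring_scope.

(** * The biquadratic relation over F[t] *)

Definition psize (R : nzSemiRingType) (p : {poly R}) := size p.

(* The library states sizes over several carriers that are only convertible to
   each other (field, integral domain, semiring), which [lia] takes for distinct
   atoms. *)
Ltac size_lia :=
  repeat match goal with
  | H : context [@size ?T (@polyseq ?R ?p)] |- _ =>
      change (@size T (@polyseq R p)) with (psize p) in H
  | |- context [@size ?T (@polyseq ?R ?p)] =>
      change (@size T (@polyseq R p)) with (psize p)
  end; lia.

(** * Degree estimates for polynomials *)

Section PolySize.
Variable F : fieldType.

Lemma size_linear_le (p : {poly F}) m : (size p < m)%N -> (size ('X * p)%R <= m)%N.
Proof.
by move=> pm; apply: leq_trans (size_polyMleq _ _) _; rewrite size_polyX.
Qed.

Lemma size_constM_le (c p : {poly F}) m :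
  (size c <= 1)%N -> (size p <= m)%N -> (size (c * p)%R <= m)%N.
Proof. by move=> c1 pm; have := size_polyMleq c p; size_lia. Qed.

Lemma size_mul_le (p q : {poly F}) m n :
  (size p <= m)%N -> (size q <= n)%N -> (size (p * q)%R <= (m + n).-1)%N.
Proof. by move=> c1 pm; have := size_polyMleq p q; size_lia. Qed.

Lemma size_add_le (p q : {poly F}) m :
  (size p <= m)%N -> (size q <= m)%N -> (size (p + q)%R <= m)%N.
Proof. by move=> pm qm; rewrite (leq_trans (size_polyD _ _)) // geq_max pm. Qed.

Lemma size_sub_le (p q : {poly F}) m :
  (size p <= m)%N -> (size q <= m)%N -> (size (p - q)%R <= m)%N.
Proof. by move=> pm qm; rewrite size_add_le ?size_polyN. Qed.

Lemma size_nat_le n : (size (n%:R : {poly F}) <= 1)%N.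
Proof. by rewrite -polyC_natr size_polyC_leq1. Qed.

(** Meant for the two roots [A / B] and [C / D] of a quadratic with coefficients [D * B],
    [B * C + A * D], [C * A], the last of largest degree. If [A / B] had no pole at infinity,
    [B * C] would have size at least [m], so the small sum forces [A * D] to the same size; then [D]
    is at least as large as [C], and [D * B] at least as large as [C * A]. *)
Lemma size_num_gt_den (A B C D : {poly F}) m :
  (size (D * B)%R < m)%N -> (size (B * C + A * D)%R < m)%N -> size (C * A) = m ->
  (size B < size A)%N.
Proof.
move=> sDB sS sCA; rewrite ltnNge; apply/negP => leAB.
have m_gt0 : (0 < m)%N by size_lia.
have /andP[C0 A0] : (C != 0) && (A != 0).
  by rewrite -negb_or -mulf_eq0 -size_poly_gt0 sCA.
have B0 : B != 0 by move: A0; rewrite -!size_poly_gt0; size_lia.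
have sBC : (m <= size (B * C)%R)%N.
  move: sCA; rewrite !size_mul // addnC => <-; size_lia.
have sAD : size (A * D) = size (B * C).
  case: (ltngtP (size (A * D)) (size (B * C))) => [lt|lt|eq]; last exact: eq.
    by move: sS; rewrite (size_polyDl lt); size_lia.
  by move: sS; rewrite addrC (size_polyDl lt); size_lia.
have D0 : D != 0.
  by apply/eqP => D0; move: sAD; rewrite D0 mulr0 size_poly0; size_lia.
move: sAD sBC sDB; rewrite !size_mul //; size_lia.
Qed.

End PolySize.

Section Chain.
Variables (F : fieldType) (a b : F).
Definition weier : {poly F} := 'X^3 + a%:P * 'X + b%:P.

(* For points U, V with x(V) = t, the values x(U + V) and x(U - V) are the roots
   of a quadratic whose coefficients, once x(U) = P.1 / P.2 is put in, are the
   three polynomials below.  The curve is the twist f(t) y^2 = x^3 + a x + b over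
   F(t), with V = (t, 1); the twist does not affect the x-coordinates. *)
Definition kum0 (P : {poly F} * {poly F}) := (P.1 - 'X * P.2) ^+ 2.
Definition kum1 (P : {poly F} * {poly F}) :=
  2 * ((P.1 + 'X * P.2) * ('X * P.1 + a%:P * P.2) + 2 * b%:P * P.2 ^+ 2).
Definition kum2 (P : {poly F} * {poly F}) :=
  ('X * P.1 - a%:P * P.2) ^+ 2 - 4 * b%:P * P.2 * (P.1 + 'X * P.2).

Definition linked (P Q : {poly F} * {poly F}) :=
  kum0 P * Q.1 ^+ 2 - kum1 P * Q.1 * Q.2 + kum2 P * Q.2 ^+ 2 = 0.

(* A fraction P.1 / P.2 in lowest terms with a pole at infinity; the point at
   infinity is the fraction (1, 0). *)
Definition admissible (P : {poly F} * {poly F}) :=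
  coprimep P.1 P.2 && (size P.2 < size P.1)%N.

Lemma linked_sym P Q : linked P Q -> linked Q P.
Proof. by rewrite /linked => <-; rewrite /kum0 /kum1 /kum2; ring. Qed.

Lemma size_kum (P : {poly F} * {poly F}) : (size P.2 < size P.1)%N ->
  [/\ (size (kum0 P) <= (size P.1).*2.-1)%N,
      (size (kum1 P) <= (size P.1).*2)%N &
      size (kum2 P) = (size P.1).*2.+1].
Proof.
case: P => R S /= lSR; move em: (size R) lSR => m lSR.
have sXS : (size ('X * S)%R <= m)%N by apply: size_linear_le.
have sR : (size R <= m)%N by rewrite em.
have sXR : (size ('X * R)%R <= m.+1)%N by apply: size_linear_le.
have sa := size_polyC_leq1 a; have sb := size_polyC_leq1 b.
have saS : (size (a%:P * S)%R <= m.-1)%N by apply: size_constM_le => //; size_lia.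
have sRXS : (size (R + 'X * S)%R <= m)%N by apply: size_add_le.
split.
- rewrite /kum0 /= expr2 -addnn; apply: size_mul_le; exact: size_sub_le.
- rewrite /kum1 /=; apply: size_constM_le; first exact: size_nat_le.
  apply: size_add_le.
    rewrite -[m.*2]/((m.*2).+1.-1) -addnn -addnS; apply: size_mul_le => //.
    by apply: size_add_le => //; size_lia.
  rewrite -mulrA; apply: size_constM_le; first exact: size_nat_le.
  apply: size_constM_le => //; rewrite expr2.
  have := size_mul_le (leqnn (size S)) (leqnn (size S)); size_lia.
- have szXR : size ('X * R) = m.+1.
    by rewrite mulrC size_mulX ?em // -size_poly_gt0 em; size_lia.
  (* The square carries the leading term: all the rest has size at most [2 * m]. *)
  have -> : kum2 (R, S) = ('X * R) ^+ 2
     - ('X * R * (2 * (a%:P * S)) - (a%:P * S) * (a%:P * S)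
        + 4 * ((b%:P * S) * (R + 'X * S))).
    by rewrite /kum2 /=; ring.
  have sz2 : size (('X * R) ^+ 2) = m.*2.+1.
    by rewrite expr2 size_mul -?size_poly_gt0 szXR //; size_lia.
  rewrite size_polyDl // size_polyN sz2 ltnS.
  have sc : (size (a%:P * S)%R <= m)%N by size_lia.
  have s1 := size_constM_le (size_nat_le F 2) saS.
  have s2 : (size (b%:P * S)%R <= m)%N by apply: size_constM_le => //; size_lia.
  apply: size_add_le; first apply: size_sub_le.
  + by have := size_mul_le sXR s1; size_lia.
  + by have := size_mul_le saS saS; size_lia.
  + apply: size_constM_le; first exact: size_nat_le.
    by have := size_mul_le s2 sRXS; size_lia.
Qed.

Hypothesis two_neq0 : (2 : F) != 0.
Hypothesis disc_neq0 : 4 * a ^+ 3 + 27 * b ^+ 2 != 0.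

Lemma coprime_weier_deriv : coprimep weier (3 * 'X^2 + a%:P).
Proof.
apply/Bezout_eq1_coprimepP.
(* Cofactors expressing the discriminant through [weier] and its derivative, divided by the
   discriminant. *)
exists ((4 * a ^+ 3 + 27 * b ^+ 2)^-1%:P * (- 18 * a%:P * 'X + 27 * b%:P),
        (4 * a ^+ 3 + 27 * b ^+ 2)^-1%:P
          * (6 * a%:P * 'X^2 - 9 * b%:P * 'X + 4 * a%:P ^+ 2)) => /=.
transitivity ((4 * a ^+ 3 + 27 * b ^+ 2)^-1%:P
              * (4 * a ^+ 3 + 27 * b ^+ 2)%:P : {poly F}).
  by rewrite /weier; move: (_^-1%:P) => c; ring.
by rewrite -polyCM mulVf.
Qed.

(** Modulo [R - 'X * S] the polynomials [kum1] and [kum2] become [4 * S ^+ 2 * f] and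
    [S ^+ 2 * (f' ^+ 2 - 8 * 'X * f)], as in the duplication formula. A common factor of [d] and
    [R - 'X * S] is prime to [S], so it divides [f] and [f' ^+ 2] and is constant; since [d] divides
    [(R - 'X * S) ^+ 2], so is [d]. *)
Lemma kum_coprime P d : coprimep P.1 P.2 ->
  d %| kum0 P -> d %| kum1 P -> d %| kum2 P -> d %= 1.
Proof.
case: P => R S /= cRS d0 d1 d2; rewrite -size_poly_eq1 -coprimepp.
suff c1 : coprimep d (R - 'X * S).
  have : coprimep d (kum0 (R, S)) by rewrite coprimep_expr.
  by apply: coprimep_dvdl.
apply/coprimepP => e ed eRS.
have eS : coprimep e S.
  apply/coprimepP => g ge gS.
  have gR : g %| R.
    rewrite -(subrK ('X * S) R); apply: dvdp_add; first exact: dvdp_trans eRS.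
    exact: dvdp_mull.
  by move/coprimepP: cRS; apply.
have two_neq0P : (2 : {poly F})= 2%:P by rewrite polyCMn.
have ef : e %| weier.
  have : e %| 4 * (S ^+ 2 * weier).
    have -> : 4 * (S ^+ 2 * weier) = kum1 (R, S) - (R - 'X * S) *
      (2 * (('X * R + a%:P * S) + 2 * 'X^2 * S)).
      rewrite /kum1 /weier /=; ring.
    by apply: dvdp_sub; [exact: dvdp_trans d1 | exact: dvdp_mulr].
  have -> : (4 : {poly F}) = (2 * 2)%:P by rewrite polyCM -two_neq0P; ring.
  rewrite mul_polyC dvdpZr ?mulf_neq0 //.
  by rewrite Gauss_dvdpr // coprimep_expr.
have ef' : e %| (3 * 'X^2 + a%:P) ^+ 2.
  have : e %| S ^+ 2 * (3 * 'X^2 + a%:P) ^+ 2.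
    have -> : S ^+ 2 * (3 * 'X^2 + a%:P) ^+ 2 =
      kum2 (R, S) + 8 * 'X * S ^+ 2 * weier
      - (R - 'X * S) * ('X * ('X * R - a%:P * S + 'X^2 * S - a%:P * S)
                         - 4 * b%:P * S).
      by rewrite /kum2 /weier /=; ring.
    apply: dvdp_sub; last exact: dvdp_mulr.
    by apply: dvdp_add; [exact: dvdp_trans d2 | exact: dvdp_mull].
  by rewrite Gauss_dvdpr // coprimep_expr.
have : coprimep weier ((3 * 'X^2 + a%:P) ^+ 2).
  by rewrite coprimep_expr ?coprime_weier_deriv.
by move/coprimepP; apply.
Qed.

(* Vieta jumping: Q is one root of the quadratic attached to P, T is the other. *)
Lemma linked_next P Q : admissible P -> admissible Q -> linked P Q ->
  exists T, [/\ admissible T, linked P T &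
                size T.1 + size Q.1 = (size P.1).*2 + 2]%N.
Proof.
case: P Q => R S [C D] admP /andP[/= cCD lDC] lPQ.
have /andP[/= cRS lSR] := admP.
have [s0 s1 s2] := @size_kum (R, S) lSR; rewrite /= in s0 s1 s2.
have C0 : C != 0 by rewrite -size_poly_gt0; size_lia.
(* Rational root argument: [C / D] is a root in lowest terms, so [C] divides the constant
   coefficient, [D] the leading one, and the quadratic splits over the polynomial ring. *)
have [A [B [e0 e1 e2]]] : exists A B, [/\ kum0 (R, S) = D * B,
    kum1 (R, S) = B * C + A * D & kum2 (R, S) = C * A].
  move: lPQ; rewrite /linked /=.
  move: (kum0 _) (kum1 _) (kum2 _) => al be ga eq0.
  have /dvdpP[A eA] : C %| ga.
    have : C %| ga * D ^+ 2.
      have -> : ga * D ^+ 2 = C * (be * D - al * C).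
        by apply/eqP; rewrite -subr_eq0 -eq0; apply/eqP; ring.
      by rewrite dvdp_mulr.
    by rewrite Gauss_dvdpl // coprimep_expr.
  (* [D = 0] is the point at infinity: [C] is then a unit and [kum0] vanishes. *)
  have [D0|D0] := eqVneq D 0.
    have /dvdpP[B eB] : C %| be.
      by move: cCD; rewrite D0 coprimep0 => /eqp_dvdl ->; rewrite dvd1p.
    exists A, B; split; last by rewrite eA mulrC.
      move: eq0; rewrite D0 mul0r expr0n /= !mulr0 subr0 addr0 => /eqP.
      by rewrite mulf_eq0 expf_eq0 (negPf C0) /= orbF => /eqP.
    by rewrite D0 mulr0 addr0.
  have /dvdpP[B eB] : D %| al.
    have : D %| al * C ^+ 2.
      have -> : al * C ^+ 2 = D * (be * C - ga * D).
        by apply/eqP; rewrite -subr_eq0 -eq0; apply/eqP; ring.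
      by rewrite dvdp_mulr.
    by rewrite Gauss_dvdpl // coprimep_expr // coprimep_sym.
  exists A, B; split; [by rewrite eB mulrC | | by rewrite eA mulrC].
  apply: (mulfI C0); apply: (mulIf D0).
  by apply/eqP; rewrite eq_sym -subr_eq0 -eq0 eA eB; apply/eqP; ring.
have cAB : coprimep A B.
  rewrite /coprimep size_poly_eq1; apply: (@kum_coprime (R, S)) => //.
  - by rewrite e0 dvdp_mull // dvdp_gcdr.
  - by rewrite e1 dvdp_add // ?dvdp_mulr ?dvdp_gcdl ?dvdp_gcdr.
  - by rewrite e2 dvdp_mull // dvdp_gcdl.
have A0 : A != 0.
  by apply/eqP => A0; move: s2; rewrite e2 A0 mulr0 size_poly0.
exists (A, B) => /=; split.
- apply/andP; split=> //=; apply: (@size_num_gt_den F A B C D (size R).*2.+1).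
  + by rewrite -e0; size_lia.
  + by rewrite -e1; size_lia.
  + by rewrite -e2.
- by rewrite /linked e0 e1 e2 /=; ring.
- by move: s2; rewrite e2 size_mul // ; move: C0 A0; rewrite -!size_poly_gt0; size_lia.
Qed.

(** By [linked_next] the numerator degrees have constant second difference 2; [d n] is the closed
    form with the first two degrees as initial values, and a nonzero numerator has nonnegative
    degree. *)
Lemma linked_chain (P Q : {poly F} * {poly F}) (n : nat) : admissible P -> admissible Q -> linked P Q ->
  ((size P.1)%:Z - 1 + n%:Z * ((size Q.1)%:Z - (size P.1)%:Z - 1) + n%:Z ^+ 2 >= 0 :> int).
Proof.
move=> aP aQ lPQ.
pose d n := ((size P.1)%:Z - 1 + n%:Z * ((size Q.1)%:Z - (size P.1)%:Z - 1)
             + n%:Z ^+ 2 : int).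
suff [S [T [[/andP[_ aS] _ _] dS _]]] : exists S T,
    [/\ [/\ admissible S, admissible T & linked S T],
        (size S.1)%:Z = d n + 1 & (size T.1)%:Z = d n.+1 + 1].
  by rewrite -/(d n); size_lia.
elim: n => [|n [S [T [[aS aT lST] dS dT]]]].
  by exists P, Q; rewrite /d; split=> //; ring.
have [U [aU lTU sU]] := linked_next aT aS (linked_sym lST).
exists T, U; split=> //.
have -> : (size U.1)%:Z = (size T.1)%:Z * 2 + 2 - (size S.1)%:Z by size_lia.
rewrite dS dT /d -!natz; ring.
Qed.
End Chain.

(** * The first two points *)

Section ProdXsubC.
Variable F : finFieldType.

Definition prodX (P : pred F) : {poly F} := \prod_(c | P c) ('X - c%:P).

Lemma prodXE P : prodX P = \prod_(c <- enum P) ('X - c%:P).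
Proof. by rewrite big_enum. Qed.

Lemma size_prodX P : size (prodX P) = #|P|.+1.
Proof. by rewrite prodXE size_prod_XsubC -cardE. Qed.

Lemma root_prodX P c : root (prodX P) c = P c.
Proof. by rewrite prodXE root_prod_XsubC mem_enum. Qed.

Lemma prodX_dvdp (P : pred F) p : (forall c, P c -> root p c) -> prodX P %| p.
Proof.
move=> rP; rewrite prodXE uniq_roots_dvdp ?uniq_rootsE ?enum_uniq //.
by apply/allP => c; rewrite mem_enum; apply: rP.
Qed.

Lemma coprimep_prodX (P : pred F) p : (forall c, P c -> ~~ root p c) -> coprimep p (prodX P).
Proof.
move=> rP; rewrite /prodX; elim/big_ind: _ => [|q r cq cr|c /rP].
- exact: coprimep1.
- by rewrite coprimepMr cq.
- by rewrite coprimep_XsubC.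
Qed.

Lemma prodX_neq0 P : prodX P != 0.
Proof. by rewrite -size_poly_gt0 size_prodX. Qed.

End ProdXsubC.

(** * Euler's criterion and the number of square roots *)

Section SquareRoots.
Variables (F : finFieldType) (m : nat).
Hypothesis cardF : #|F| = m.*2.+1.
Hypothesis two_neq0 : (2 : F) != 0.

Lemma half_pow_cases (c : F) : [|| c ^+ m == 0, c ^+ m == 1 | c ^+ m == -1].
Proof.
have [->|c0] := eqVneq c 0; last first.
  have /(mulfI c0) e : c * c ^+ m.*2 = c * 1 by rewrite -exprS -cardF expf_card mulr1.
  rewrite -eqf_sqr expr1n -exprM muln2 e eqxx orbT //.
by case: m cardF => [|k]; rewrite ?expr0 ?eqxx ?orbT // expr0n eqxx.
Qed.

(** The unit group is cyclic of order [2 * m]: for [c = g ^+ k] the hypothesis makes [2 * m] divide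
    [k * m], so [k] is even. *)
Lemma half_pow1_sqrt (c : F) : c ^+ m = 1 -> exists y, y ^+ 2 = c.
Proof.
move=> cm.
have m_gt0 : (0 < m)%N.
  have := card_finNzRing_gt1 F; rewrite cardF; lia.
have c0 : c != 0.
  by apply/eqP => c0; move/eqP: cm; rewrite c0 expr0n eqn0Ngt m_gt0 eq_sym oner_eq0.
have Uc : c \is a GRing.unit by rewrite unitfE.
have /cyclicP[g eg] := field_unit_group_cyclic [set: {unit F}]%G.
have := in_setT (FinRing.unit F Uc); rewrite eg => /cycleP[k ek].
have og : #[g]%g = m.*2.
  by rewrite orderE -eg card_finField_unit cardF.
have : (g ^+ (k * m) == 1)%g.
  apply/eqP/val_inj; rewrite expgM -ek FinRing.val_unitX /=; exact: cm.
rewrite -order_dvdn og -mul2n dvdn_pmul2r // dvdn2 => evk.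
exists (FinRing.uval g ^+ k./2).
rewrite -exprM muln2 halfK (negPf evk) subn0.
by have := congr1 (@FinRing.uval F) ek; rewrite FinRing.val_unitX.
Qed.

Lemma card_sqrt (c : F) :
  #|[set y : F | y ^+ 2 == c]| = ((c == 0%R) + (c ^+ m == 1%R).*2)%N.
Proof.
have m_gt0 : (0 < m)%N.
  have := card_finNzRing_gt1 F; rewrite cardF; lia.
have [c0|c0] := eqVneq c 0.
  rewrite c0 expr0n eqn0Ngt m_gt0 eq_sym oner_eq0 /= addn0.
  rewrite -(cards1 (0 : F)); apply: eq_card => y.
  by rewrite !inE expf_eq0.
case: eqP => [/half_pow1_sqrt[y ey]|cm].
  have y0 : y != 0 by apply: contraNneq c0 => y0; rewrite -ey y0 expr0n.
  have yNy : y != - y.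
    by rewrite -subr_eq0 opprK -mulr2n -mulr_natl mulf_neq0.
  transitivity #|[set y; - y]|; last by rewrite cards2 yNy.
  by apply: eq_card => x; rewrite !inE -ey eqf_sqr.
apply/eqP; rewrite cards_eq0; apply/eqP/setP => y; rewrite !inE.
apply/eqP => ey; apply: cm.
have y0 : y != 0 by apply: contraNneq c0 => y0; rewrite -ey y0 expr0n.
by apply: (mulfI y0); rewrite -ey -exprM mul2n -exprS -cardF expf_card mulr1.
Qed.
End SquareRoots.

(** * The Frobenius point and its difference with [(t, 1)] *)

Section Start.
Variables (F : finFieldType) (m : nat) (a b : F).
Hypothesis cardF : #|F| = m.*2.+1.
Hypothesis two_neq0 : (2 : F) != 0.

Definition weier_count :=
  #|[set P : F * F | P.2 ^+ 2 == P.1 ^+ 3 + a * P.1 + b]|.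

Local Notation f := (weier a b).

Lemma horner_weier c : f.[c] = c ^+ 3 + a * c + b.
Proof. by rewrite /weier !hornerE. Qed.

Let m_gt0 : (0 < m)%N.
Proof. by have := card_finNzRing_gt1 F; rewrite cardF; lia. Qed.

(** The classes are cut out by Euler's criterion, which makes each a root condition on [f ^+ m],
    shifted by a constant. *)
Definition zeros : pred F := fun c => f.[c] ^+ m == 0.
Definition squares : pred F := fun c => f.[c] ^+ m == 1.
Definition nonsquares : pred F := fun c => f.[c] ^+ m == -1.

Lemma zerosE c : zeros c = root f c.
Proof. by rewrite /zeros expf_eq0 m_gt0. Qed.

Lemma weier_count_sum : weier_count =
  (\sum_c ((f.[c] ^+ m == 0%R) + (f.[c] ^+ m == 1%R).*2))%N.
Proof.
rewrite /weier_count -sum1dep_card.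
transitivity (\sum_c \sum_(y | y ^+ 2 == f.[c]) 1)%N.
  rewrite pair_big_dep /=; apply: eq_bigl => -[x y] /=.
  by rewrite horner_weier.
apply: eq_bigr => c _.
by rewrite sum1dep_card (card_sqrt cardF) // expf_eq0 m_gt0.
Qed.

Lemma weier_countE : weier_count = (#|zeros| + #|squares|.*2)%N.
Proof.
have sum_pred (P : pred F) : (\sum_c (P c : nat))%N = #|P|.
  by rewrite -sum1_card [RHS]big_mkcond; apply: eq_bigr => c _; rewrite unfold_in; case: (P c).
rewrite -2!sum_pred -muln2 big_distrl -big_split /= weier_count_sum.
by apply: eq_bigr => c _; rewrite muln2.
Qed.

Lemma genPoly_split :
  'X^#|F| - 'X = prodX zeros * prodX nonsquares * prodX squares :> {poly F}.
Proof.
have one_neqN1 : (1 : F) != -1.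
  by rewrite -subr_eq0 opprK.
rewrite finField_genPoly (bigID zeros) (bigID nonsquares (fun c => ~~ _)) /=.
rewrite mulrA; congr (_ * _ * _); apply: eq_bigl => c /=.
  rewrite andbC /zeros /nonsquares; case: eqP => //= ->.
  by rewrite oppr_eq0 oner_eq0.
rewrite /zeros /nonsquares /squares.
case/or3P: (half_pow_cases cardF f.[c]) => /eqP->.
- by rewrite !eqxx [0 == 1]eq_sym oner_eq0.
- by rewrite oner_eq0 (negPf one_neqN1) eqxx.
- by rewrite !eqxx andbF eq_sym (negPf one_neqN1).
Qed.

Lemma card_split : #|F| = (#|zeros| + #|nonsquares| + #|squares|)%N.
Proof.
have := congr1 (fun p : {poly F} => size p) genPoly_split.
rewrite size_polyDl ?size_polyN ?size_polyXn ?size_polyX; last by rewrite cardF; lia.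
by rewrite !size_mul ?mulf_neq0 ?prodX_neq0 // !size_prodX; lia.
Qed.

Hypothesis charF : [pchar F].-nat #|F|.

Lemma weier_expF : f ^+ #|F| = ('X^#|F|) ^+ 3 + a%:P * 'X^#|F| + b%:P.
Proof.
have charP : [pchar {poly F}].-nat #|F|.
  by rewrite (eq_pnat _ (pchar_poly F)).
rewrite /weier !exprDn_pchar // ['X^3 ^+ _]exprAC [(a%:P * _) ^+ _]exprMn.
by rewrite -!polyC_exp !expf_card.
Qed.

Let h := f ^+ m.
Let u : {poly F} := 'X^#|F|.

(* Over the denominator (u - 'X) ^+ 2 this is x(U - V) for U = (u, h), where h is
   the y-coordinate f^((q-1)/2) of the Frobenius point. *)
Definition shift_num : {poly F} := f * (h + 1) ^+ 2 - (u + 'X) * (u - 'X) ^+ 2.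

Lemma weier_half : f * h ^+ 2 = u ^+ 3 + a%:P * u + b%:P.
Proof. by rewrite -weier_expF /h -exprM muln2 -exprS -cardF. Qed.

(** The curve equation at the Frobenius point cancels the terms of degree [3q], leaving
    [u ^+ 2 * 'X] as leading term. *)
Lemma shift_numE :
  shift_num = (u + 'X) * (u * 'X + a%:P) + 2 * b%:P + 2 * (f * h).
Proof.
rewrite /shift_num.
have -> : f * (h + 1) ^+ 2 = f * h ^+ 2 + 2 * (f * h) + f by ring.
by rewrite weier_half /weier; ring.
Qed.

Lemma size_weier : size f = 4%N.
Proof.
rewrite /weier -addrA size_polyDl ?size_polyXn // ltnS.
apply: size_add_le; last by rewrite (leq_trans (size_polyC_leq1 b)).
apply: size_constM_le; first exact: size_polyC_leq1.
by rewrite size_polyX.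
Qed.

Lemma size_shift_num : size shift_num = (#|F|.*2 + 2)%N.
Proof.
have su : size u = #|F|.+1 by rewrite size_polyXn.
have -> : shift_num = 'X^(#|F|.*2.+1)
    + (a%:P * u + 'X * ('X * u + a%:P) + 2 * b%:P + 2 * (f * h)).
  by rewrite shift_numE exprS -addnn exprD -/u; ring.
rewrite size_polyDl size_polyXn ?addn2 // ltnS.
have sa := size_polyC_leq1 a; have sb := size_polyC_leq1 b.
have sh : (size h <= (3 * m).+1)%N.
  by rewrite /h; have := size_poly_exp_leq f m; rewrite size_weier.
apply: size_add_le; last first.
  apply: size_constM_le; first exact: size_nat_le.
  have := size_mul_le (leqnn (size f)) sh; rewrite size_weier; size_lia.
apply: size_add_le; last first.
  by apply: size_constM_le; [exact: size_nat_le | size_lia].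
apply: size_add_le.
  by apply: size_constM_le => //; rewrite su; lia.
apply: size_linear_le; rewrite ltnS; apply: size_add_le; last by size_lia.
by apply: size_linear_le; rewrite su; lia.
Qed.

(** This is [linked] for [(u, 1)] and [(shift_num, (u - 'X) ^+ 2)], divided by
    [kum0 (u, 1) = (u - 'X) ^+ 2]. *)
Lemma linked_start_aux :
  shift_num ^+ 2 - kum1 a b (u, 1) * shift_num + kum2 a b (u, 1) * (u - 'X) ^+ 2 = 0.
Proof.
transitivity (4 * f * (f * h ^+ 2 - (u ^+ 3 + a%:P * u + b%:P))).
  by rewrite shift_numE /kum1 /kum2 /weier /=; ring.
by rewrite weier_half subrr mulr0.
Qed.

Hypothesis disc_neq0 : 4 * a ^+ 3 + 27 * b ^+ 2 != 0.

(** The point count enters through reduction to lowest terms: [Z * N ^+ 2] cancels between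
    [shift_num] and [(u - 'X) ^+ 2 = (Z * N * S) ^+ 2]. The degree [2q + 1] of [shift_num] drops by
    [#|zeros| + 2 * #|nonsquares|], which leaves [#|zeros| + 2 * #|squares| + 1]. *)
Lemma linked_start : exists Q,
  [/\ admissible Q, linked a b (u, 1) Q & size Q.1 = (weier_count + 2)%N].
Proof.
set Z := prodX zeros; set N := prodX nonsquares; set S := prodX squares.
have eu : u - 'X = Z * N * S by exact: genPoly_split.
have /dvdpP[f1 ef] : Z %| f.
  by apply: prodX_dvdp => c; rewrite zerosE.
have /dvdpP[h1 eh] : N %| h + 1.
  apply: prodX_dvdp => c /eqP fc; rewrite rootE /h hornerD horner_exp hornerC fc.
  by rewrite addNr.
pose M' := f1 * h1 ^+ 2 - (u + 'X) * (Z * S ^+ 2).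
have eM : shift_num = Z * N ^+ 2 * M'.
  by rewrite /shift_num eu ef eh /M'; ring.
have nz := (prodX_neq0 zeros, prodX_neq0 nonsquares, prodX_neq0 squares).
have sMq := size_shift_num.
have M0 : M' != 0.
  apply/eqP => M0; move: sMq; rewrite eM M0 mulr0 size_poly0; lia.
have sM : size M' = (weier_count + 2)%N.
  move: sMq; rewrite eM size_mul ?mulf_neq0 ?expf_neq0 ?nz //.
  rewrite size_mul ?expf_neq0 ?nz // expr2 size_mul ?nz // !size_prodX.
  rewrite weier_countE card_split; size_lia.
have sZS : size (Z * S ^+ 2) = weier_count.+1.
  rewrite size_mul ?expf_neq0 ?nz // expr2 size_mul ?nz // !size_prodX.
  rewrite weier_countE; lia.
exists (M', Z * S ^+ 2); split=> //.
- apply/andP; split; last by rewrite /= sM sZS; lia.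
  rewrite /= coprimep_sym.
  have -> : M' = - (u + 'X) * (Z * S ^+ 2) + f1 * h1 ^+ 2 by rewrite /M'; ring.
  have hornerh c : (h + 1).[c] = f.[c] ^+ m + 1 by rewrite /h hornerD horner_exp hornerC.
  have h1N c : f.[c] ^+ m + 1 != 0 -> ~~ root h1 c.
    apply: contra => /eqP rc.
    by rewrite -hornerh eh hornerM rc mul0r.
  (* At a root of [Z], [h + 1] is 1 and [f1] is nonzero because [f] has simple roots; at a root of
     [S], [h + 1] is 2 and [f] itself is nonzero. *)
  rewrite coprimep_addl_mul coprimep_sym coprimepMr; apply/andP; split.
    apply: coprimep_prodX => c zc; rewrite rootM expr2 rootM orbb negb_or.
    apply/andP; split; last first.
      by apply: h1N; move/eqP: zc => ->; rewrite add0r oner_eq0.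
    have rf : root f c by rewrite -zerosE.
    have := coprimep_root (coprime_weier_deriv disc_neq0) rf.
    apply: contra => /eqP f1c.
    have -> : 3 * 'X^2 + a%:P = f^`().
      rewrite /weier !derivE /=; ring.
    have /eqP Zc : root Z c by rewrite root_prodX.
    by rewrite ef derivM !hornerE f1c Zc mulr0 mul0r addr0.
  apply: coprimep_expr; apply: coprimep_prodX => c /eqP sc.
  rewrite rootM expr2 rootM orbb negb_or h1N ?sc ?andbT //.
  apply/negP => /eqP f1c; move/eqP: sc.
  by rewrite ef hornerM f1c mul0r expr0n eqn0Ngt m_gt0 eq_sym oner_eq0.
(* Multiplied by the square of the cancelled factor, the relation becomes [(u - 'X) ^+ 2] times
   [linked_start_aux]. *)
- have /mulfI : (Z * N ^+ 2) ^+ 2 != 0 by rewrite expf_neq0 ?mulf_neq0 ?expf_neq0 ?nz.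
  apply; rewrite mulr0.
  have /(congr1 (fun p => (u - 'X) ^+ 2 * p)) := linked_start_aux.
  rewrite mulr0 => <-; rewrite /linked /= -/(kum1 _ _ _).
  rewrite /kum0 /= mulr1 eM eu; ring.
Qed.

End Start.

(** * Hasse's bound and the trace modulo the characteristic *)

Section PowerSums.
Variable F : finFieldType.

Lemma card_natr_eq0 : #|F|%:R = 0 :> F.
Proof.
have /eqP : \sum_(c : F) (c + 1) = \sum_(c : F) c.
  by rewrite [RHS](reindex_inj (addIr 1)).
by rewrite big_split /= sumr_const -subr_eq0 addrAC subrr add0r => /eqP.
Qed.

(** For [i > 0], ['X^i - 1] has too few roots to kill all units; multiplying by a unit [g] with
    [g ^+ i != 1] permutes the field but scales the sum. *)
Lemma sum_expr_lt i : (i < #|F|.-1)%N -> \sum_(c : F) c ^+ i = 0.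
Proof.
case: i => [|i] lti; first by rewrite sumr_const card_natr_eq0.
have [g g0 gi] : exists2 g : F, g != 0 & g ^+ i.+1 != 1.
  case: (pickP (fun g : F => (g != 0) && (g ^+ i.+1 != 1))) => [g /andP[]|no].
    by exists g.
  have Xi0 : 'X^(i.+1) - 1%:P != 0 :> {poly F}.
    by rewrite -size_poly_gt0 size_XnsubC.
  have rts : all (root ('X^(i.+1) - 1%:P)) (enum (predC1 (0 : F))).
    apply/allP => c; rewrite mem_enum => c0.
    rewrite rootE !hornerE subr_eq0; have := no c.
    by rewrite -[c != 0]/(c \in predC1 0) c0 /= => /negbFE.
  have := max_poly_roots Xi0 rts (enum_uniq _).
  by rewrite -cardE cardC1 size_XnsubC // ltnS leqNgt lti.
have : \sum_(c : F) c ^+ i.+1 = g ^+ i.+1 * \sum_(c : F) c ^+ i.+1.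
  rewrite big_distrr /= (reindex_inj (mulfI g0)).
  by apply: eq_bigr => c _; rewrite exprMn.
move/eqP; rewrite -subr_eq0 -{1}[\sum_c _]mul1r -mulrBl mulf_eq0.
by rewrite subr_eq0 eq_sym (negPf gi) => /eqP.
Qed.

Lemma sum_expr_pred : \sum_(c : F) c ^+ #|F|.-1 = -1.
Proof.
have q1 := card_finNzRing_gt1 F.
have eq_q : #|F|.-1.+1 = #|F| by rewrite prednK // ltnW.
have q_gt1 : (#|F|.-1 == 0%N) = false.
  by apply/negbTE; rewrite -lt0n -ltnS eq_q.
rewrite (bigD1 0) //= expr0n q_gt1 add0r (eq_bigr (fun=> 1)).
  rewrite sumr_const; have -> : #|predC1 (0 : F)| = #|F|.-1 by rewrite cardC1.
  by apply/eqP; rewrite -addr_eq0 -mulrSr eq_q card_natr_eq0.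
by move=> c c0; apply: (mulfI c0); rewrite -exprS eq_q expf_card mulr1.
Qed.

(** Below degree [2 * q] the only positive multiple of [q] is [q] itself; an exponent [i > q] acts
    on the field as [i - q], whose power sum vanishes. *)
Lemma sum_horner (P : {poly F}) q : #|F| = q.+1 -> (size P <= q.*2)%N ->
  \sum_(c : F) P.[c] = - P`_q.
Proof.
move=> cardF sP.
have q_gt0 : (0 < q)%N by have := card_finNzRing_gt1 F; rewrite cardF.
have sum_lt i : (i < q)%N -> \sum_(c : F) c ^+ i = 0.
  by move=> lti; rewrite sum_expr_lt // cardF.
rewrite (eq_bigr (fun c => \sum_(i < q.*2) P`_i * c ^+ i)); last first.
  by move=> c _; apply: horner_coef_wide.
rewrite exchange_big /=; under eq_bigr => i _ do rewrite -big_distrr /=.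
have lt_q : (q < q.*2)%N by lia.
have := sum_expr_pred; rewrite cardF /= => sum_q.
rewrite (bigD1 (Ordinal lt_q)) //= sum_q mulrN1 big1 ?addr0 // => i ne_i.
have [lti|] := ltnP i q; first by rewrite sum_lt ?mulr0.
rewrite leq_eqVlt => /orP[/eqP ei|gti].
  by case/eqP: ne_i; apply: val_inj.
rewrite (eq_bigr (fun c => c ^+ (i - q))); last first.
  move=> c _; have -> : nat_of_ord i = ((i - q).-1 + #|F|)%N by rewrite cardF; lia.
  by rewrite exprD expf_card -exprSr; congr (_ ^+ _); rewrite cardF; lia.
by rewrite sum_lt ?mulr0 //; have := ltn_ord i; lia.
Qed.
End PowerSums.

(** In [F] the number of square roots of [f.[c]] is [1 + f.[c] ^+ m]; the ones sum to 0, and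
    [f ^+ m] has degree [3 * m < 4 * m]. *)
Lemma weier_count_coef (F : finFieldType) (m : nat) (a b : F) :
  #|F| = m.*2.+1 -> (2 : F) != 0 ->
  (weier_count a b)%:R = - (weier a b ^+ m)`_(m.*2) :> F.
Proof.
move=> cardF two_neq0.
have m_gt0 : (0 < m)%N by have := card_finNzRing_gt1 F; rewrite cardF; lia.
rewrite -(sum_horner cardF); last first.
  have := size_poly_exp_leq (weier a b) m; rewrite size_weier; size_lia.
rewrite (weier_count_sum _ _ cardF two_neq0) natr_sum.
transitivity (\sum_(c : F) 1 + \sum_c (weier a b ^+ m).[c]); last first.
  by rewrite sumr_const card_natr_eq0 add0r.
rewrite -big_split /=.
apply: eq_bigr => c _; rewrite horner_exp natrD -muln2 natrM.
have one_neqN1 : (1 : F) != -1 by rewrite -subr_eq0 opprK.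
case/or3P: (half_pow_cases cardF (weier a b).[c]) => /eqP->.
- by rewrite eqxx [0 == 1]eq_sym oner_eq0 mul0r.
- by rewrite eqxx oner_eq0 mul1r add0r.
- by rewrite [-1 == 1]eq_sym (negPf one_neqN1) oppr_eq0 oner_eq0 mul0r addr0 subrr.
Qed.

Theorem hasse_bound (F : finFieldType) (a b : F) : prime #|F| -> (2 : F) != 0 ->
   4 * a ^+ 3 + 27 * b ^+ 2 != 0 ->
  ((weier_count a b)%:Z - #|F|%:Z) ^+ 2 <= 4 * #|F|%:Z :> int.
Proof.
move=> pr_q two_neq0 disc_neq0.
have q_neq2 : #|F| != 2%N.
  by apply: contraNneq two_neq0 => q2; rewrite -q2 card_natr_eq0.
have odd_q : odd #|F| by case: (even_prime pr_q) => // q2; rewrite q2 in q_neq2.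
pose m := (#|F|./2)%N.
have cardF : #|F| = m.*2.+1 by rewrite -[LHS]odd_double_half odd_q.
have charF : [pchar F].-nat #|F|.
  by rewrite pnatE // inE pr_q card_natr_eq0 eqxx.
have [Q [aQ lQ sQ]] := linked_start cardF two_neq0 charF disc_neq0.
set P : {poly F} * {poly F} := ('X^#|F|, 1).
have aP : admissible P.
  by rewrite /admissible /= coprimep1 size_polyXn size_poly1 ltnS prime_gt0.
have sP : size P.1 = #|F|.+1 by rewrite size_polyXn.
set N := weier_count a b in sQ *; set q := #|F| in cardF sP *.
have pos n : 0 <= n%:Z ^+ 2 + n%:Z * (N%:Z - q%:Z) + q%:Z :> int.
  have := linked_chain two_neq0 disc_neq0 n aP aQ lQ.
  by rewrite sP sQ; nia.
(* The chain run backwards starts at [Q], one place early, hence the index [n.+1]. *)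
have neg n : 0 <= n%:Z ^+ 2 - n%:Z * (N%:Z - q%:Z) + q%:Z :> int.
  have := linked_chain two_neq0 disc_neq0 n.+1 aQ aP (linked_sym lQ).
  by rewrite sP sQ; nia.
set D := N%:Z - q%:Z in pos neg *.
have quad n : 0 <= n%:Z ^+ 2 - n%:Z * `|D| + q%:Z :> int.
  case: (lerP 0 D) => [/ger0_norm->|/ltr0_norm->]; first exact: neg.
  by rewrite mulrN opprK; apply: pos.
have -> : D ^+ 2 = `|D|%N%:Z ^+ 2 by rewrite abszE real_normK ?num_real.
move: quad; rewrite -abszE; move: `|D|%N => A quad.
(* The integer nearest the vertex suffices. For [A = 2n] it gives [n ^ 2 <= q]; for [A = 2n + 1] it
   gives [n * (n + 1) <= q], strict by parity, so [A ^ 2 = 4 * n * (n + 1) + 1] stays below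
   [4 * q]. *)
have := quad A./2; have oq : odd q by [].
have : odd (A./2 * A./2.+1) = false by rewrite oddM /= andbN.
have := odd_double_half A; move: (A./2) => n; case: (odd A) => <- /=.
  move=> even_n le_q; have ne : (n * n.+1)%N != q by apply: contraFneq even_n => ->.
  nia.
nia.
Qed.

(** * Digits *)

Lemma horner_digit (P : {poly nat}) (b i : nat) :
  (forall j, (P`_j)%R < b)%N -> (P.[b]%R %/ b ^ i %% b)%N = P`_i.
Proof.
elim/poly_ind: P i => [|P c IH] i ltb.
  by rewrite horner0 coef0 div0n mod0n.
have b_gt0 : (0 < b)%N by apply: leq_ltn_trans (ltb 0%N).
have ltc : (c < b)%N by have := ltb 0%N; rewrite coefD coefMX coefC add0r.
have ltP j : ((P`_j)%R < b)%N.
  by have := ltb j.+1; rewrite coefD coefMX coefC /= addr0.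
rewrite hornerD hornerMX hornerC coefD coefMX coefC.
rewrite -[_ + c]/(P.[b]%R * b + c)%N.
case: i => [|i] /=; first by rewrite expn0 divn1 modnMDl modn_small ?add0r.
by rewrite expnS divnMA divnMDl // (divn_small ltc) addn0 IH ?addr0.
Qed.

Lemma coef_le_horner1 (P : {poly nat}) j : ((P`_j)%R <= P.[1]%R)%N.
Proof.
have [szP|ltj] := leqP (size P) j; first by rewrite nth_default.
rewrite horner_coef (bigD1 (Ordinal ltj)) //= expr1n mulr1.
exact: leq_addr.
Qed.

Definition cubic (a b : nat) : {poly nat} := 'X^3 + a%:P * 'X + b%:P.

Lemma horner_cubic a b x : (cubic a b).[x] = (x ^ 3 + a * x + b)%N.
Proof. by rewrite /cubic !hornerE. Qed.

(** No carries occur in base [2 ^ (p ^ 2)]: a coefficient is at most the value at 1, and the cubic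
    is at most [2 * p - 1 < 2 ^ p] there. *)
Lemma trace_residueE (A B p : nat) : (0 < p)%N ->
  trace_residue A B p = (((cubic (A %% p) (B %% p) ^+ p./2)`_(p - 1)%N)%R %% p)%N.
Proof.
move=> p_gt0; rewrite /trace_residue; congr (_ %% p)%N.
rewrite -(@horner_digit _ (2 ^ p ^ 2)%N); last first.
  move=> j; apply: leq_ltn_trans (coef_le_horner1 _ _) _.
  rewrite horner_exp horner_cubic -[_ ^+ _]/(_ ^ _)%N exp1n muln1.
  have lt2p : (1 + A %% p + B %% p < 2 ^ p)%N.
    have := ltn_pmod A p_gt0; have := ltn_pmod B p_gt0.
    have := ltn_expl p.-1 (isT : (1 < 2)%N).
    have : (2 ^ p = 2 * 2 ^ p.-1)%N by rewrite -expnS prednK.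
    lia.
  have [-> | h0] := posnP p./2; first by rewrite expn0 -{1}(expn0 2) ltn_exp2l // expn_gt0 p_gt0.
  apply: (@leq_trans ((2 ^ p) ^ p./2)); first by rewrite ltn_exp2r.
  by rewrite -expnM leq_exp2l // -mulnn leq_pmul2l //; lia.
rewrite horner_exp horner_cubic -[_ ^+ _]/(_ ^ _)%N divn2 -!expnM.
by rewrite [(p ^ 2 * 3)%N]mulnC.
Qed.

Lemma natr_coef_cubic (F : fieldType) (a b n i : nat) :
  ((cubic a b ^+ n)`_i)%R%:R = (weier (a%:R : F) b%:R ^+ n)`_i.
Proof.
rewrite -[LHS](coef_map (GRing.natmul (1 : F))) rmorphXn /=.
by rewrite /cubic !rmorphD rmorphM rmorphXn /= !map_polyC map_polyX.
Qed.

Definition Fp_count (A B p : nat) := weier_count (A%:R : 'F_p) B%:R.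

Lemma Fp_count_trace (A B p : nat) : prime p -> (2 < p)%N ->
  (p %| Fp_count A B p + trace_residue A B p)%N.
Proof.
move=> pr_p p_gt2; have p_gt0 := prime_gt0 pr_p.
have charp := pchar_Fp pr_p.
have two_neq0 : (2 : 'F_p) != 0 by rewrite -(dvdn_pcharf charp) gtnNdvd.
have cardF : #|'F_p| = p./2.*2.+1.
  rewrite card_Fp // -[LHS]odd_double_half.
  by case: (even_prime pr_p) => [p2|->] //; rewrite p2 in p_gt2.
rewrite (dvdn_pcharf charp) natrD /Fp_count (weier_count_coef _ _ cardF two_neq0).
have nat_mod n : (n %% p)%:R = n%:R :> 'F_p.
  by rewrite {2}(divn_eq n p) natrD natrM (pcharf0 charp) mulr0 add0r.
rewrite trace_residueE // nat_mod natr_coef_cubic !nat_mod.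
have -> : (p - 1)%N = p./2.*2.
  by apply: succn_inj; rewrite -cardF card_Fp // subn1 prednK.
by rewrite addNr.
Qed.

Lemma Fp_countE (A B p : nat) : prime p -> (17 <= p)%N ->
  ~~ (p %| 4 * A ^ 3 + 27 * B ^ 2)%N ->
  let r := trace_residue A B p in
  Fp_count A B p = ((p - r) + p * (1 - ((4 * p + 1) - r ^ 2)))%N.
Proof.
move=> pr_p p_ge17 disc r; have p_gt0 := prime_gt0 pr_p.
have charp := pchar_Fp pr_p.
have /= := @hasse_bound 'F_p A%:R B%:R; rewrite card_Fp // -/(Fp_count A B p).
have two_neq0 : (2 : 'F_p) != 0 by rewrite -(dvdn_pcharf charp) gtnNdvd //; lia.
have disc_neq0 : 4 * A%:R ^+ 3 + 27 * B%:R ^+ 2 != 0 :> 'F_p.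
  by rewrite -!natrX -!natrM -natrD -(dvdn_pcharf charp).
move=> /(_ pr_p two_neq0 disc_neq0).
have /dvdnP[k] : (p %| Fp_count A B p + r)%N by apply: Fp_count_trace => //; lia.
have : (r < p)%N by rewrite /r /trace_residue ltn_mod.
move: (Fp_count A B p) (r) => N s lts eN le_hasse.
(* [k = 0] forces [N = 0] and [k >= 3] forces [N > 2 * p]; either way [N] is at distance at least
   [p] from [p], against Hasse's bound. *)
have k_gt0 : (0 < k)%N.
  by case: k eN => // eN; nia.
have k_lt3 : (k < 3)%N by rewrite ltnNge; apply/negP => k3; nia.
have [k1|k2] : k = 1%N \/ k = 2%N by lia.
  have es : N%:Z - p%:Z = - s%:Z by lia.
  have s_small : (s ^ 2 <= 4 * p)%N by move: le_hasse; rewrite es sqrrN; lia.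
  have -> : (1 - (4 * p + 1 - s ^ 2) = 0)%N by lia.
  by rewrite muln0; lia.
have es : N%:Z - p%:Z = (p - s)%N%:Z by lia.
have s_small : ((p - s) ^ 2 <= 4 * p)%N by move: le_hasse; rewrite es; lia.
have s_large : (4 * p < s ^ 2)%N.
  (* If [s] and [p - s] both had square at most [4 * p], then [p ^ 2 <= 2 * ((p - s) ^ 2 + s ^ 2) <=
     16 * p]; this is where [p >= 17] enters. *)
  rewrite ltnNge; apply/negP => s_le.
  have ep : ((p - s) + s = p)%N by rewrite subnK // ltnW.
  have [AGM _] := nat_Cauchy (p - s) s.
  have : (p ^ 2 <= 16 * p)%N by rewrite -{1}ep sqrnD; lia.
  by rewrite -mulnn leq_pmul2r //; lia.
have -> : (1 - (4 * p + 1 - s ^ 2) = 1)%N by lia.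
by rewrite muln1; lia.
Qed.

(** * Hensel lifting *)

Definition curve_eqn (A B x y : int) : int := y ^+ 2 - (x ^+ 3 + A * x + B).

(** Integer representatives let a residue modulo [q * p] be written [x + q * i]. *)
Definition residue_count (A B m : nat) : nat :=
  (\sum_(x < m) \sum_(y < m) (m %| curve_eqn A B x y)%Z)%N.

Lemma affine_countE (A B m : nat) : (1 < m)%N ->
  affine_count A B m = residue_count A B m.
Proof.
case: m => [|[|m]] // _.
rewrite /affine_count /residue_count -sum1dep_card.
rewrite pair_bigA big_mkcond /=; apply: eq_bigr => -[x y] _ /=.
suff -> : (y ^+ 2 == x ^+ 3 + A%:R * x + B%:R :> 'Z_(m.+2))
    = (m.+2 %| curve_eqn A B x y)%Z by case: (_ %| _)%Z.
have -> : (y ^+ 2 == x ^+ 3 + A%:R * x + B%:R :> 'Z_(m.+2))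
    = ((y ^ 2)%N%:R == (x ^ 3 + A * x + B)%N%:R :> 'Z_(m.+2)).
  by rewrite !natrD natrM !natrX !natr_Zp.
rewrite /curve_eqn.
have -> : y%:Z ^+ 2 - (x%:Z ^+ 3 + A%:Z * x%:Z + B%:Z)
   = (y ^ 2)%N%:Z - (x ^ 3 + A * x + B)%N%:Z by lia.
rewrite -eqz_mod_dvd !modz_nat eqz_nat.
by rewrite -val_eqE /= !val_Zp_nat.
Qed.

Lemma sum_ord_mul (G : nat -> nat) (q p : nat) :
  (\sum_(x < q * p) G x = \sum_(x < q) \sum_(i < p) G (x + q * i))%N.
Proof.
rewrite exchange_big /=; elim: p => [|p IH].
  by rewrite big_ord0 muln0 big_ord0.
rewrite big_ord_recr -IH /= mulnS addnC.
rewrite -(big_mkord xpredT) -[in RHS](big_mkord xpredT G).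
rewrite (big_cat_nat _ (n := q * p)) ?leq_addr //=; congr addn.
rewrite -{1}[(q * p)%N]add0n big_addn addKn big_mkord.
by apply: eq_bigr => x _.
Qed.

Lemma sum_Fp (G : nat -> nat) (p : nat) : prime p ->
  (\sum_(i < p) G i = \sum_(c : 'F_p) G c)%N.
Proof. by move=> pr_p; rewrite -(big_mkord xpredT G) -{1}(Fp_cast pr_p) big_mkord. Qed.

Lemma sum_Fp2 (G : nat -> nat -> nat) (p : nat) : prime p ->
  (\sum_(i < p) \sum_(j < p) G i j = \sum_(c : 'F_p) \sum_(d : 'F_p) G c d)%N.
Proof.
move=> pr_p; rewrite (sum_Fp (fun i => \sum_(j < p) G i j)%N pr_p).
by apply: eq_bigr => c _; apply: sum_Fp.
Qed.

Lemma residue_count_prime (A B p : nat) : prime p ->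
  residue_count A B p = Fp_count A B p.
Proof.
move=> pr_p; rewrite /residue_count /Fp_count /weier_count -sum1dep_card.
rewrite (sum_Fp2 (fun x y => (p %| curve_eqn A B x y)%Z : nat) pr_p).
rewrite pair_bigA [RHS]big_mkcond /=; apply: eq_bigr => -[x y] _ /=.
suff -> : (y ^+ 2 == x ^+ 3 + A%:R * x + B%:R :> 'F_p)
    = (p %| curve_eqn A B x y)%Z by case: (_ %| _)%Z.
rewrite (dvdz_pcharf (pchar_Fp pr_p)) /curve_eqn.
by rewrite rmorphB !rmorphD !rmorphXn rmorphM /= -!pmulrn !natr_Zp subr_eq0.
Qed.


Lemma card_affine_line (F : finFieldType) (e al be : F) :
  (al != 0) || (be != 0) ->
  (\sum_i \sum_j ((e + al * i + be * j)%R == 0%R))%N = #|F|.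
Proof.
have line (c d : F) : d != 0 -> (\sum_j ((c + d * j)%R == 0%R))%N = 1%N.
  move=> d0; rewrite (bigD1 (- c / d)) //= mulrC divfK // addrN eqxx big1 // => j.
  move=> nj; apply/eqP; rewrite eqb0; apply: contra nj => /eqP e0.
  by apply/eqP; apply: (mulfI d0); rewrite [RHS]mulrC divfK // -[d * j](addKr c) e0 addr0.
case/orP => d0; last first.
  by rewrite (eq_bigr (fun=> 1%N)) ?sum1_card // => i _; apply: line.
rewrite exchange_big (eq_bigr (fun=> 1%N)) ?sum1_card // => j _ /=.
rewrite -(line (e + be * j) al d0).
by apply: eq_bigr => i _; rewrite addrAC.
Qed.

(** If [y = 0] then [x] is a root of the cubic, and coprimality with the derivative makes it
    simple. *)
Lemma weier_nonsingular (F : fieldType) (a b x y : F) :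
  (2 : F) != 0 -> 4 * a ^+ 3 + 27 * b ^+ 2 != 0 -> y ^+ 2 = x ^+ 3 + a * x + b ->
  (- (3 * x ^+ 2 + a) != 0) || (2 * y != 0).
Proof.
move=> two_neq0 disc_neq0 exy; rewrite oppr_eq0 mulf_eq0 (negPf two_neq0) /=.
apply/orP; have [y0|] := eqVneq y 0; last by right.
left; have := coprimep_root (coprime_weier_deriv disc_neq0) (x := x).
have rx : root (weier a b) x.
  by rewrite rootE /weier !hornerE -exy y0 expr0n.
by move/(_ rx); rewrite hornerD hornerC -polyC_natr hornerCM hornerXn.
Qed.

(** Hensel's argument: since [p] divides [q], only the first-order Taylor terms survive modulo
    [q * p]. Over a solution with value [q * e] the lifts form an affine line in [(i, j)] modulo
    [p], because the gradient is nonzero; elsewhere there are none. *)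
Lemma lift_count (A B p q x y : nat) : prime p -> (2 < p)%N -> (p %| q)%N ->
  ~~ (p %| 4 * A ^ 3 + 27 * B ^ 2)%N -> (0 < q)%N ->
  (\sum_(i < p) \sum_(j < p)
     ((q * p)%N %| curve_eqn A B (x + q * i)%N (y + q * j)%N)%Z
   = (q %| curve_eqn A B x y)%Z * p)%N.
Proof.
move=> pr_p p_gt2 dvd_pq disc q_gt0; have charp := pchar_Fp pr_p.
have [q' eq'] := dvdnP dvd_pq.
have taylor (i j : nat) : exists w : int, curve_eqn A B (x + q * i)%N (y + q * j)%N =
   curve_eqn A B x y
   + q%:Z * (- (3 * x%:Z ^+ 2 + A%:Z) * i%:Z + 2 * y%:Z * j%:Z) + (q * p)%N%:Z * w.
  (* The remainder is a multiple of [q ^ 2 = (q * p) * q']. *)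
  exists (q'%:Z * (j%:Z ^+ 2 - 3 * x%:Z * i%:Z ^+ 2 - q%:Z * i%:Z ^+ 3)).
  have -> : (q * p)%N%:Z * (q'%:Z * (j%:Z ^+ 2 - 3 * x%:Z * i%:Z ^+ 2 - q%:Z * i%:Z ^+ 3))
    = q%:Z * q%:Z * (j%:Z ^+ 2 - 3 * x%:Z * i%:Z ^+ 2 - q%:Z * i%:Z ^+ 3).
    by rewrite {4}eq' !PoszM; ring.
  rewrite /curve_eqn !PoszD !PoszM; ring.
have [/dvdzP[e ee]|ndvd] := boolP (q %| curve_eqn A B x y)%Z; last first.
  rewrite mul0n big1 // => i _; rewrite big1 // => j _.
  apply/eqP; rewrite eqb0; apply: contra ndvd => dvd1.
  have [w ew] := taylor i j.
  have : (q %| curve_eqn A B (x + q * i)%N (y + q * j)%N)%Z.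
    by apply: dvdz_trans dvd1; rewrite PoszM dvdz_mulr.
  by rewrite ew PoszM -addrA -[_ * p%:Z * w]mulrA -mulrDr rpredDr // dvdz_mulr.
have two_neq0 : (2 : 'F_p) != 0 by rewrite -(dvdn_pcharf charp) gtnNdvd.
have disc_neq0 : 4 * A%:R ^+ 3 + 27 * B%:R ^+ 2 != 0 :> 'F_p.
  by rewrite -!natrX -!natrM -natrD -(dvdn_pcharf charp).
have p_dvd_eqn : (p %| curve_eqn A B x y)%Z.
  by rewrite ee eq' PoszM mulrA dvdz_mull.
have eqn_p : y%:R ^+ 2 = x%:R ^+ 3 + A%:R * x%:R + B%:R :> 'F_p.
  move: p_dvd_eqn; rewrite (dvdz_pcharf charp) /curve_eqn.
  by rewrite rmorphB !rmorphD !rmorphXn rmorphM /= -!pmulrn subr_eq0 => /eqP.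
have := weier_nonsingular two_neq0 disc_neq0 eqn_p.
move/(card_affine_line e%:~R); rewrite card_Fp // => count.
rewrite mul1n -[RHS]count.
pose G (i j : nat) : nat :=
  e%:~R + - (3 * x%:R ^+ 2 + A%:R) * i%:R + 2 * y%:R * j%:R == 0 :> 'F_p.
transitivity (\sum_(i < p) \sum_(j < p) G i j)%N.
  apply: eq_bigr => i _; apply: eq_bigr => j _; congr nat_of_bool.
  have [w ->] := taylor i j.
  rewrite rpredDr ?dvdz_mulr // ee [e * _]mulrC -mulrDr PoszM.
  rewrite dvdz_mul2l ?eqz_nat -?lt0n // (dvdz_pcharf charp).
  rewrite !(rmorphD, rmorphM, rmorphN, rmorphXn) /= -!pmulrn addrA.
  by congr (_ == _); ring.
rewrite (sum_Fp2 G pr_p); apply: eq_bigr => i _; apply: eq_bigr => j _.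
by rewrite /G !natr_Zp.
Qed.

Lemma residue_count_step (A B p q : nat) : prime p -> (2 < p)%N -> (p %| q)%N ->
  ~~ (p %| 4 * A ^ 3 + 27 * B ^ 2)%N -> (0 < q)%N ->
  residue_count A B (q * p) = (p * residue_count A B q)%N.
Proof.
move=> pr_p p_gt2 dvd_pq disc q_gt0; rewrite /residue_count.
rewrite (sum_ord_mul (fun x => \sum_(y < q * p) ((q * p)%N %| curve_eqn A B x y)%Z)%N).
rewrite big_distrr; apply: eq_bigr => x _ /=; rewrite big_distrr /=.
under eq_bigr => i _ do
  rewrite (sum_ord_mul (fun y => ((q * p)%N %| curve_eqn A B (x + q * i)%N y)%Z : nat)).
rewrite exchange_big /=; apply: eq_bigr => y _.
by rewrite [RHS]mulnC; apply: lift_count.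
Qed.

Lemma affine_count_prime_power (A B p k : nat) : prime p -> (2 < p)%N ->
  ~~ (p %| 4 * A ^ 3 + 27 * B ^ 2)%N ->
  affine_count A B (p ^ k.+1) = (p ^ k * Fp_count A B p)%N.
Proof.
move=> pr_p p_gt2 disc.
rewrite affine_countE; last by rewrite -{1}(expn0 p) ltn_exp2l ?prime_gt1.
elim: k => [|k IH]; first by rewrite expn1 mul1n residue_count_prime.
rewrite [in LHS]expnSr residue_count_step //; first by rewrite IH mulnA -expnS.
  by rewrite expnS dvdn_mulr.
by rewrite expn_gt0 prime_gt0.
Qed.

(** * The arithmetic term *)

Local Open Scope nat_scope.

Definition tmod (n : nat) (u v : aterm n) : aterm n :=
  TSub u (TMul (TDiv u v) v).

Lemma aeval_mod (n : nat) (e : n.-tuple nat) (u v : aterm n) (a b : nat) :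
  aeval e u = Some a -> aeval e v = Some b -> 0 < b ->
  aeval e (tmod u v) = Some (a %% b).
Proof.
by move=> /= -> -> b_gt0; rewrite b_gt0 {1}(divn_eq a b) addKn.
Qed.

Definition trace_term : aterm 4 :=
  let A := TVar (Ordinal (isT : 0 < 4)) in
  let B := TVar (Ordinal (isT : 1 < 4)) in
  let p := TVar (Ordinal (isT : 2 < 4)) in
  let p2 := TExp p (TConst 4 2) in
  let f := TAdd (TAdd (TExp (TConst 4 2) (TMul (TConst 4 3) p2))
                      (TMul (tmod A p) (TExp (TConst 4 2) p2)))
                (tmod B p) in
  tmod (tmod (TDiv (TExp f (TDiv p (TConst 4 2)))
                   (TExp (TConst 4 2) (TMul p2 (TSub p (TConst 4 1)))))
             (TExp (TConst 4 2) p2)) p.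

Definition count_term : aterm 4 :=
  let p := TVar (Ordinal (isT : 2 < 4)) in
  let k := TVar (Ordinal (isT : 3 < 4)) in
  let r := trace_term in
  TMul (TExp p (TSub k (TConst 4 1)))
    (TAdd (TSub p r)
       (TMul p (TSub (TConst 4 1)
          (TSub (TAdd (TMul (TConst 4 4) p) (TConst 4 1)) (TExp r (TConst 4 2)))))).

Lemma aeval_trace_term (A B p k : nat) : 0 < p ->
  aeval [tuple A; B; p; k] trace_term = Some (trace_residue A B p).
Proof.
move=> p_gt0; rewrite /trace_term /trace_residue.
apply: aeval_mod => //; apply: aeval_mod => //; last by rewrite expn_gt0.
have tmodE a b (u v : aterm 4) e := @aeval_mod 4 e u v a b.
cbn [aeval]; rewrite (tmodE A p) // (tmodE B p) //.
by rewrite /= expn_gt0.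
Qed.

Lemma aeval_count_term (A B p k : nat) : 0 < p ->
  let r := trace_residue A B p in
  aeval [tuple A; B; p; k] count_term
  = Some (p ^ (k - 1) * ((p - r) + p * (1 - ((4 * p + 1) - r ^ 2)))).
Proof.
by move=> p_gt0; rewrite /count_term; cbn [aeval]; rewrite aeval_trace_term.
Qed.

Theorem corollary10 :
  exists t : aterm 4,
    forall A B p k : nat,
      prime p -> 17 <= p -> ~~ (p %| 4 * A ^ 3 + 27 * B ^ 2) -> 1 <= k ->
      let r := trace_residue A B p in
      let N := p ^ (k - 1)
               * ((p - r) + p * (1 - ((4 * p + 1) - r ^ 2))) in
      affine_count A B (p ^ k) = N /\ aeval [tuple A; B; p; k] t = Some N.
Proof.
exists count_term => A B p k pr_p p_ge17 disc k_gt0 r N.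
split; last exact: aeval_count_term (prime_gt0 pr_p).
case: k @N k_gt0 => // k N _.
rewrite affine_count_prime_power ?(leq_trans _ p_ge17) //.
by rewrite /N subn1 Fp_countE.
Qed.
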